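(* For every integer $t\ge 2$ there exists a number $m_0$ such that for every integer $m\ge m_0$ the following holds. Let $d=\gcd(3^m-2^m,\,2^m-1)$, $l_3=\frac{3^m-1}{d}$ and $l_4=2^m+1$. Then the seed number $S(m,t)$ is bounded above by the $(t-1)$st smallest of the values $a l_3+b l_4$ over all integers $a,b\ge 0$ with $(a,b)\neq(0,0)$, and the seed value is $V(m,t)=S(m,t)\cdot 2^m$.
   Context: For positive integers $n,m,t$, $T(n,m,t)$ denotes the least number that is the sum of $n$ positive $m$th powers (i.e. $\sum_{i=1}^n a_i^m$ with all $a_i$ positive integers) in at least $t$ ways, provided such a number exists. Two ways are regarded as different if they differ as multisets of terms (order is irrelevant). The seed number $S(m,t)$ is the smallest positive integer $s_0$ such that $T(n+1,m,t)=T(n,m,t)+1$ for all $n\ge s_0$ (in particular these values of $T$ exist), and the seed value is $V(m,t)=T(S(m,t),m,t)$. *)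

(* Defs.v *)
From mathcomp Require Import all_boot.

Set Implicit Arguments.
Unset Strict Implicit.
Unset Printing Implicit Defensive.

Definition is_least (P : nat -> Prop) (x : nat) : Prop :=
  P x /\ forall y, P y -> x <= y.

Definition is_way (n m N : nat) (s : seq nat) : bool :=
  [&& size s == n, all (fun a => 0 < a) s & \sum_(a <- s) a ^ m == N].

(* Lists related by [perm_eq] are the same multiset, hence the same way. *)
Definition in_at_least_ways (n m t N : nat) : Prop :=
  exists W : seq (seq nat),
    [/\ size W = t, all (is_way n m N) W
      & pairwise (fun s1 s2 => ~~ perm_eq s1 s2) W].

(* The partial functions T, S and V are given by their graphs: [is_T n m t v]
   says that T(n, m, t) exists and equals v, and similarly below. *)
Definition is_T (n m t : nat) : nat -> Prop :=
  is_least (in_at_least_ways n m t).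

Definition is_seed_number (m t : nat) : nat -> Prop :=
  is_least (fun s0 => 0 < s0 /\
    forall n, s0 <= n -> exists v, is_T n m t v /\ is_T n.+1 m t v.+1).

Definition is_seed_value (m t v : nat) : Prop :=
  exists s, is_seed_number m t s /\ is_T s m t v.

(* B is the k-th smallest (k >= 1) member of the family (f i), i in P, where a
   value attained at several indices is counted once for each of them:
   r lists k indices in nondecreasing order of value, ending at B, and every
   index not listed has value at least B. *)
Definition is_kth_smallest (I : eqType) (P : pred I) (f : I -> nat)
    (k B : nat) : Prop :=
  exists r : seq I,
    [/\ uniq r, size r = k & all P r] /\
    [/\ sorted leq (map f r), last 0 (map f r) = B
      & forall i, P i -> i \notin r -> B <= f i].

(* Main.v *)
Require Import Defs.
From Stdlib Require Import Classical.
From mathcomp Require Import all_boot all_algebra.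
From mathcomp Require Import zify ring.

(** Fix m and t, and write T(n) for T(n, m, t).  A sum of n positive m-th powers
    is n plus its excess, the sum of a^m - 1 over the terms a^m; terms equal to
    1 contribute nothing.  Two exchanges preserve both the number of terms and
    the sum:
    - l3 twos become x threes and y ones, where x = (2^m - 1) / d and
      y = (3^m - 2^m) / d;
    - l4 twos become one four and 2^m ones, since 4^m + 2^m = (2^m + 1) 2^m.
    Performing the first a times and the second b times on a supply of twos
    consumes a l3 + b l4 of them.  Let B be the (t-1)st smallest value of
    a l3 + b l4 over the nonzero pairs (a, b).  With the pair (0, 0), this makes
    t representations of the sum of B twos; adding ones gives
    T(n) <= n + B (2^m - 1) for n >= B.

    The converse bound holds for every n ([ways_lower_bound]).  Take t
    representations of N with n terms.  If a term is at least 5, the excess is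
    at least 5^m - 1, which exceeds B (2^m - 1) for large m.  Otherwise discard
    the threes common to all of the representations: one of them then has no
    three, so the excess that is left is a multiple k (2^m - 1), as
    2^m - 1 divides 4^m - 1; and in each of them the number of threes is a
    multiple of x.  So the representations come from k twos by exchanges, along
    t distinct pairs (a, b) with a l3 + b l4 <= k, whence k >= B
    ([ways_exchange]).  Therefore T(n) = n + B (2^m - 1) for n >= B, and
    S(m, t) <= B.

    In fact S(m, t) = B.  If not, T(B - 1) = T(B) - 1, and there are t
    representations with B - 1 terms and excess B (2^m - 1).  None of them
    consists of twos and ones only, as that would need B twos; so t nonzero
    pairs (a, b) have value at most B, and the value B is taken twice
    ([short_way_dvd]).  Such a tie reads a l3 = b l4 with 0 < b < t, and implies
    that 3^m - 1 divides b (4^m - 1).  What remains, and is the heart of the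
    matter, is that for bounded b > 0 this divisibility holds for finitely many
    m only ([eventually_not_dvd]).

    This is a question about approximating 1 by a ratio of numbers that are
    powers of 3 and 4 up to small factors, and Thue's method with two solutions
    settles it.  If v (3^m - 1) = b (4^m - 1), put p = b 4^m and q = v 3^m; then
    r = q - p = v - b is positive and of order (4/3)^m only.  Let M be a large
    solution with data p, q, r, and let m be a solution with data p', q', r', so
    large that m / M is about 2 l for a large odd l.  The Pade approximants of
    degree l of the function z^(2 l) at z = 1, evaluated at z = q / p and
    combined with q' / p', give an integer
        p' H + r' G,  where q^(2 l) divides H - G and p^(2 l) divides G,
    with G and H positive and explicit.  It is divisible by 12^(2 l M), because
    p, p' are divisible by powers of 4 and q, q' by powers of 3; but its size is
    about (64 * 16 / 9)^(l M), which is smaller than 144^(l M).  Since M is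
    large, the binomial coefficients in G and H, which are of size c^l, do no
    harm.  The oddness of l makes both terms of the integer positive, so that it
    cannot vanish. *)

Set Implicit Arguments.
Unset Strict Implicit.
Unset Printing Implicit Defensive.

Import GRing.Theory.

(** * Powers *)

Lemma leq_expn2r (a b n : nat) : a <= b -> a ^ n <= b ^ n.
Proof. by case: n => // n le_ab; rewrite leq_exp2r. Qed.

Lemma PoszX (a n : nat) : Posz (a ^ n) = (Posz a ^+ n)%R.
Proof. by rewrite -[LHS]natz natrX natz. Qed.

(** Bernoulli's inequality, in the form (a + m) a^m <= a b^m. *)
Lemma expn_dominates (a b K m : nat) :
  0 < a < b -> a * K <= m -> K * a ^ m <= b ^ m.
Proof.
case/andP=> a_gt0 lt_ab le_m.
have bern k : (a + k) * a ^ k <= a * b ^ k.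
  elim: k => [|k IH]; first by rewrite addn0.
  rewrite !expnS.
  have h : a * b ^ k * b >= a * b ^ k * a.+1 by rewrite leq_mul2l lt_ab orbT.
  have h2 : (a + k) * a ^ k * a.+1 <= a * b ^ k * a.+1 by rewrite leq_mul2r IH orbT.
  apply: (@leq_trans ((a + k) * a ^ k * a.+1)); last by nia.
  by nia.
rewrite -(leq_pmul2l a_gt0) mulnA; apply: leq_trans (bern m).
by rewrite leq_mul2r; apply/orP; right; lia.
Qed.

(** * Binomial sums with a polynomial weight *)

Definition binomial_sum (p r : int) (n : nat) (f : nat -> int) : int :=
  (\sum_(j < n.+1) 'C(n, j)%:Z * f j * r ^+ j * p ^+ (n - j))%R.

Local Open Scope ring_scope.

Lemma binomial_sumS (p r : int) n f :
  binomial_sum p r n.+1 f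
  = p * binomial_sum p r n f + r * binomial_sum p r n (f \o succn).
Proof.
rewrite /binomial_sum big_ord_recl /= bin0 expr0 subn0 mul1r mulr1.
under eq_bigr => i _ do rewrite /bump /= add1n subSS binS PoszD !mulrDl.
rewrite big_split /= addrA; congr (_ + _); last first.
  by rewrite big_distrr; apply: eq_bigr => i _ /=; rewrite exprS; ring.
rewrite [in RHS]big_ord_recl /= bin0 expr0 subn0 mul1r mulr1 mulrDr.
congr (_ + _); first by rewrite exprS; ring.
rewrite big_ord_recr /= bin_small // !mul0r addr0 big_distrr.
apply: eq_bigr => i _; rewrite /bump /= add1n.
by rewrite -(subnSK (ltn_ord i)) !exprS; ring.
Qed.

(** The value at j of the polynomial C(X - c, l) of degree l, negative upper
    arguments included. *)
Definition bin_shift (c l j : nat) : int :=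
  if (c <= j)%N then 'C(j - c, l)%:Z else (-1) ^+ l * 'C((c - j).-1 + l, l)%:Z.

Lemma bin_shiftS c l j :
  bin_shift c l.+1 j.+1 = bin_shift c l.+1 j + bin_shift c l j.
Proof.
rewrite /bin_shift; case: (leqP c j) => [cj | jc].
  by rewrite leqW // subSn // binS PoszD.
case: (eqVneq c j.+1) => [->|neq].
  rewrite leqnn subnn subSn // subnn /= add0n add0n !binn exprS.
  by rewrite bin0n /=; ring.
have -> : (c <= j.+1)%N = false by lia.
have -> : (c - j).-1 = (c - j.+1).-1.+1 by lia.
by rewrite addSn addnS (binS (_.+1)) addSn PoszD exprS; ring.
Qed.

(** With S(n, f) for the sum and f' for the forward difference of f,
    [binomial_sumS] says S(n + 1, f) = (p + r) S(n, f) + r S(n, f').  A constant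
    weight gives (p + r)^n, and each degree of the weight costs one power of
    p + r, since differences lower the degree by [bin_shiftS]. *)
Lemma binomial_sum_dvd (p r : int) c l n :
  exists A, binomial_sum p r n (bin_shift c l) = (p + r) ^+ (n - l) * A.
Proof.
elim: n l => [|n IHn] [|l].
- by exists (binomial_sum p r 0 (bin_shift c 0)); rewrite sub0n mul1r.
- by exists (binomial_sum p r 0 (bin_shift c l.+1)); rewrite sub0n mul1r.
- exists 1; rewrite subn0 mulr1 exprDn; apply: eq_bigr => j _.
  have -> : bin_shift c 0 j = 1 by rewrite /bin_shift !bin0; case: ifP.
  by rewrite -mulr_natl natz; ring.
rewrite binomial_sumS.
have -> : binomial_sum p r n (bin_shift c l.+1 \o succn)
  = binomial_sum p r n (bin_shift c l.+1) + binomial_sum p r n (bin_shift c l).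
  rewrite /binomial_sum -big_split; apply: eq_bigr => j _ /=.
  by rewrite bin_shiftS; ring.
have [A ->] := IHn l; have [A' eA'] := IHn l.+1.
case: (ltnP l n) => [ltln | lenl].
  by exists (A' + r * A); rewrite eA' subSS -(subnSK ltln) exprS; ring.
exists (p * binomial_sum p r n (bin_shift c l.+1)
  + r * (binomial_sum p r n (bin_shift c l.+1) + A)).
have -> : (n - l = 0)%N by lia.
have -> : (n.+1 - l.+1 = 0)%N by lia.
by rewrite expr0; ring.
Qed.

Local Close Scope ring_scope.

(** * Solutions of the divisibility are rare *)

(** The auxiliary integer of Thue's method.  For c = l + 1 the weight
    C(j - c, l) vanishes for l < j <= 2 l, and it is negative for j <= l, since l
    is odd.  So the binomial sum of order n = 3 l equals H - G, with G and H the
    nonnegative sums over j <= l and over j > 2 l; it is divisible by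
    (p + r)^(2 l), and G is divisible by p^(2 l).  Hence D divides
    p' (H - G) + (p' + r') G = p' H + r' G > 0.  The factor 64^l = 4^n bounds the
    sum of the products of two binomial coefficients. *)
Lemma thue_bound (l p r p' r' D : nat) :
  odd l -> r <= p -> 0 < p -> 0 < r' ->
  D %| (p + r) ^ (2 * l) * p' -> D %| p ^ (2 * l) * (p' + r') ->
  D <= 64 ^ l * (p' * (r ^ (2 * l).+1 * p ^ l.-1) + r' * p ^ (3 * l)).
Proof.
move=> l_odd le_rp p_gt0 r'_gt0 D_dvd1 D_dvd2.
have l_gt0 : 0 < l by case: (l) l_odd.
have [n nE] : {n | n = 3 * l} by exists (3 * l).
rewrite -nE.
pose g j := 'C(2 * l - j, l) * (r ^ j * p ^ (n - j)).
pose h j := 'C(j - l.+1, l) * (r ^ j * p ^ (n - j)).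
pose G := \sum_(j < n.+1 | j <= l) 'C(n, j) * g j.
pose H := \sum_(j < n.+1 | 2 * l < j) 'C(n, j) * h j.
have sumE : binomial_sum p r n (bin_shift l.+1 l) = (H%:Z - G%:Z)%R.
  rewrite /H /G !(big_morph Posz PoszD (erefl (Posz 0))).
  rewrite [X in (X - _)%R]big_mkcond [X in (_ - X)%R]big_mkcond /= -sumrB.
  apply: eq_bigr => j _; rewrite /bin_shift /g /h !PoszM !PoszX.
  case: (leqP j l) => [le_jl | lt_lj].
    have -> : (2 * l < j) = false by lia.
    rewrite -signr_odd l_odd (_ : (l.+1 - j).-1 + l = 2 * l - j); last by lia.
    by rewrite expr1; ring.
  case: ltnP => [_ | le_j]; first by ring.
  by rewrite (@bin_small (j - l.+1)) ?mulr0 ?mul0r ?subr0 //; lia.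
have p_dvd_G : p ^ (2 * l) %| G.
  apply: dvdn_sum => j le_jl; rewrite /g !dvdn_mull //.
  by apply: dvdn_exp2l; move: (nat_of_ord j) le_jl => i; lia.
have dvd_I : D %| p' * H + r' * G.
  have [A eA] := binomial_sum_dvd p r l.+1 l n.
  have nl : n - l = 2 * l by clear - nE; lia.
  rewrite sumE nl in eA.
  have /dvdnP[u eu] := D_dvd1.
  have /dvdnP[w ew] : D %| (p' + r') * G.
    apply: dvdn_trans D_dvd2 _; rewrite mulnC dvdn_pmul2l //.
    by apply: leq_trans r'_gt0 (leq_addl _ _).
  suff: (D %| Posz (p' * H + r' * G))%Z by [].
  apply/dvdzP; exists (Posz u * A + Posz w)%R.
  have {}eu : ((Posz p + Posz r) ^+ (2 * l) * Posz p' = Posz u * Posz D)%R.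
    by rewrite -PoszD -PoszX -!PoszM eu.
  have {}ew : ((Posz p' + Posz r') * Posz G = Posz w * Posz D)%R.
    by rewrite -PoszD -!PoszM ew.
  rewrite mulrDl mulrAC -eu -ew -mulrA [(Posz p' * A)%R]mulrC mulrA -eA.
  by rewrite !PoszD !PoszM; ring.
have G_gt0 : 0 < G.
  rewrite /G (bigD1 ord0) //= /g bin0 expn0 subn0 mul1n mul1n.
  rewrite addn_gt0 muln_gt0 bin_gt0 expn_gt0 p_gt0 andbT.
  by apply/orP; left; lia.
apply: leq_trans (dvdn_leq _ dvd_I) _.
  by rewrite addn_gt0 [X in _ || X]muln_gt0 r'_gt0 G_gt0 orbT.
have bin_le a b c : a <= c -> 'C(a, b) <= 2 ^ c.
  move=> le_ac; case: (leqP b a) => [le_ba | /bin_small -> //].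
  apply: (@leq_trans (2 ^ a)); last by rewrite leq_exp2l.
  rewrite -[2]/(1 + 1) expnDn (bigD1 (inord b)) //= !exp1n inordK //.
  by rewrite !muln1 leq_addr.
have sum_le (P : pred nat) (F : nat -> nat) X :
    (forall j, j <= n -> P j -> F j <= 2 ^ n * X) ->
  \sum_(j < n.+1 | P j) 'C(n, j) * F j <= 64 ^ l * X.
  move=> leF; apply: (@leq_trans (\sum_(j < n.+1) 'C(n, j) * (2 ^ n * X))).
    rewrite big_mkcond; apply: leq_sum => j _; case: ifP => // Pj.
    by rewrite leq_mul2l leF ?orbT // -ltnS.
  rewrite -big_distrl /= -(_ : 2 ^ n = \sum_(j < n.+1) 'C(n, j)).
    have nn : n + n = 6 * l by clear - nE; lia.
    by rewrite mulnA -expnD nn expnM.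
  rewrite -[2]/(1 + 1) expnDn; apply: eq_bigr => j _.
  by rewrite !exp1n !muln1.
rewrite mulnDr (mulnCA _ p') (mulnCA _ r').
apply: leq_add; rewrite leq_mul2l; apply/orP; right.
  apply: (sum_le (fun j => 2 * l < j) h) => j le_jn lt_lj; rewrite /h.
  have [i jE] : {i | j = (2 * l).+1 + i}.
    by exists (j - (2 * l).+1); rewrite subnKC.
  have iE : i + (n - j) = l.-1 by clear - jE nE le_jn l_gt0; lia.
  apply: leq_mul; first by apply: bin_le; apply: leq_trans (leq_subr _ _) le_jn.
  rewrite {1}jE expnD -mulnA leq_mul2l -iE expnD leq_mul2r leq_expn2r //.
  by rewrite !orbT.
apply: (sum_le (fun j => j <= l) g) => j le_jn le_jl; rewrite /g.
apply: leq_mul.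
  by apply: bin_le; clear - nE; lia.
apply: (@leq_trans (p ^ j * p ^ (n - j))).
  by rewrite leq_mul2r leq_expn2r ?orbT.
by rewrite -expnD subnKC.
Qed.

(** With p = b 4^m and v the quotient, r = v - b turns the divisibility into
    p + r = v 3^m. *)
Lemma quotient_gap (m b : nat) :
    0 < m -> 0 < b -> 3 ^ m - 1 %| b * (4 ^ m - 1) ->
  exists r, [/\ 0 < r, r <= b * 4 ^ m, 3 ^ m %| b * 4 ^ m + r
              & r * 3 ^ m <= 2 * b * 4 ^ m].
Proof.
move=> m_gt0 b_gt0 /dvdnP[v eqv].
have lt34 : 3 ^ m < 4 ^ m by rewrite ltn_exp2r.
have gt3 : 2 < 3 ^ m by rewrite -[2]/(3 ^ 1).-1 prednK // leq_exp2l.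
have b_lt_v : b < v by rewrite ltnNge; apply/negP => le_vb; nia.
have eqv3 : b * 4 ^ m + (v - b) = v * 3 ^ m.
  by move: eqv; rewrite !mulnBr !muln1; nia.
exists (v - b); split; first by rewrite subn_gt0.
- by nia.
- by rewrite eqv3 dvdn_mull.
by nia.
Qed.

(** The divisor 12^(2 l M) is compared with the two terms of [thue_bound] after
    multiplication by the powers of 3 that occur in the bounds for r and r'.
    Both comparisons reduce to (256 C^3 64^M)^l against 81^(l M): the constant
    256 collects 64^l from the binomial coefficients and 4^l from the factors 2
    in the bounds for r, and C^(3 l) comes from the powers of p and r. *)
Lemma no_second_solution (C M m b1 b2 l : nat) :
    0 < b1 <= C -> 0 < b2 <= C ->
    3 ^ M - 1 %| b1 * (4 ^ M - 1) -> 3 ^ m - 1 %| b2 * (4 ^ m - 1) ->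
    0 < M -> 2 * (256 * C ^ 3 * 64 ^ M) <= 81 ^ M ->
    odd l -> 4 * C * 256 ^ M < 2 ^ l -> 2 * (l * M) <= m <= 2 * (l * M) + 4 * M ->
  False.
Proof.
move=> /andP[b1_gt0 b1C] /andP[b2_gt0 b2C] dvd1 dvd2 M_gt0 bigM l_odd bigl.
case/andP=> m_ge m_le.
have l_gt0 : 0 < l by case: (l) l_odd.
have m_gt0 : 0 < m by apply: leq_trans m_ge; rewrite !muln_gt0 l_gt0.
have [r [r_gt0 le_rp dvd_r r3]] := quotient_gap M_gt0 b1_gt0 dvd1.
have [r' [r'_gt0 _ dvd_r' r3']] := quotient_gap m_gt0 b2_gt0 dvd2.
set p := b1 * 4 ^ M in le_rp dvd_r.
set p' := b2 * 4 ^ m in dvd_r'.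
have p_gt0 : 0 < p by rewrite muln_gt0 b1_gt0 expn_gt0.
set E := l * M in m_ge m_le.
have EM : M * (2 * l) = 2 * E by rewrite mulnCA [M * l]mulnC.
pose D := 3 ^ (2 * E) * 4 ^ (2 * E).
have D_le : D <= 64 ^ l * (p' * (r ^ (2 * l).+1 * p ^ l.-1) + r' * p ^ (3 * l)).
  apply: thue_bound => //; rewrite /D.
    apply: dvdn_mul; first by rewrite -EM expnM dvdn_exp2r.
    by rewrite dvdn_mull // dvdn_exp2l.
  rewrite mulnC; apply: dvdn_mul.
    by rewrite -EM expnM dvdn_exp2r // dvdn_mull.
  by apply: dvdn_trans dvd_r'; rewrite dvdn_exp2l.
pose Q := 256 * C ^ 3 * 64 ^ M.
pose X := 2 * C * 256 ^ M * 16 ^ E * Q ^ l.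
have X_lt : 2 * X < D * 3 ^ (2 * E).
  have -> : D * 3 ^ (2 * E) = 16 ^ E * (81 ^ M) ^ l.
    rewrite /D -expnM [M * l]mulnC -/E (expnM 3) (expnM 4) mulnAC -expnMn.
    by rewrite mulnC.
  have -> : 2 * X = 16 ^ E * (4 * C * 256 ^ M * Q ^ l).
    by rewrite /X; move: (256 ^ M) (16 ^ E) (Q ^ l) => x y z; clear; lia.
  rewrite ltn_pmul2l ?expn_gt0 //.
  apply: (@leq_trans (2 ^ l * Q ^ l)); last by rewrite -expnMn leq_expn2r.
  rewrite ltn_pmul2r // expn_gt0 !muln_gt0 !expn_gt0 /=.
  by rewrite (leq_trans b1_gt0 b1C).
have conclude T e : 2 * E <= e -> T * 3 ^ e <= X -> 2 * T < D.
  move=> le_e leT; rewrite -(ltn_pmul2r (_ : 0 < 3 ^ e)) ?expn_gt0 //.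
  apply: (@leq_ltn_trans (2 * X)); first by rewrite -mulnA leq_mul2l.
  by apply: leq_trans X_lt _; rewrite leq_mul2l leq_exp2l // le_e orbT.
have p_le : p <= C * 4 ^ M by rewrite leq_mul2r b1C orbT.
have p'_le : 4 ^ m <= 256 ^ M * 16 ^ E.
  apply: (@leq_trans (4 ^ (2 * E + 4 * M))); first by rewrite leq_exp2l.
  by rewrite expnD !expnM mulnC.
have XE : X = 2 * C * 256 ^ M * 16 ^ E * (256 ^ l * (C * 4 ^ M) ^ (3 * l)).
  by rewrite expnM -expnMn (expnMn C) -(expnM 4) [M * 3]mulnC (expnM 4) mulnA.
have T1 : 2 * (64 ^ l * (p' * (r ^ (2 * l).+1 * p ^ l.-1))) < D.
  apply: (conclude _ (M * (2 * l).+1)); first by rewrite mulnS EM leq_addl.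
  apply: (@leq_trans (64 ^ l * ((C * (256 ^ M * 16 ^ E))
           * ((2 * C * 4 ^ M) ^ (2 * l).+1 * (C * 4 ^ M) ^ l.-1)))).
    rewrite -mulnA leq_mul2l; apply/orP; right.
    rewrite -mulnA; apply: leq_mul; first exact: leq_mul.
    rewrite mulnAC expnM -expnMn; apply: leq_mul; last exact: leq_expn2r.
    apply: leq_expn2r; apply: leq_trans r3 _.
    by rewrite leq_mul2r leq_mul2l b1C !orbT.
  have -> : (2 * C * 4 ^ M) ^ (2 * l).+1 * (C * 4 ^ M) ^ l.-1
          = 2 * 4 ^ l * (C * 4 ^ M) ^ (3 * l).
    have -> : 3 * l = (2 * l).+1 + l.-1 by clear - l_gt0; lia.
    by rewrite -mulnA expnMn -mulnA -expnD expnS expnM.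
  rewrite XE -[256]/(64 * 4) (expnMn 64 4 l).
  move: (64 ^ l) (4 ^ l) (256 ^ M) (16 ^ E) (_ ^ (3 * l)).
  by clear; lia.
have T2 : 2 * (64 ^ l * (r' * p ^ (3 * l))) < D.
  apply: (conclude _ m m_ge).
  apply: (@leq_trans (64 ^ l * (2 * C * (256 ^ M * 16 ^ E)
                                * (C * 4 ^ M) ^ (3 * l)))).
    rewrite -mulnA leq_mul2l; apply/orP; right.
    rewrite mulnAC; apply: leq_mul; last exact: leq_expn2r.
    apply: leq_trans r3' _; apply: leq_mul => //.
    by rewrite leq_mul2l b2C orbT.
  have : 64 ^ l <= 256 ^ l by rewrite leq_expn2r.
  rewrite XE; move: (64 ^ l) (256 ^ l) (256 ^ M) (16 ^ E) (_ ^ (3 * l)).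
  move=> u v x y z le_uv.
  rewrite (_ : 2 * C * _ * _ * _ = v * (2 * C * (x * y) * z)).
    by rewrite leq_mul2r le_uv orbT.
  by clear; lia.
rewrite mulnDr in D_le; move: D_le T1 T2; clear.
by move: D (64 ^ l * _) (64 ^ l * _) => {}D u v; lia.
Qed.

(** One solution M beyond an explicit threshold excludes all solutions that are
    large compared with M.  Whether such an M exists is decided by excluded
    middle, so the bound m0 is not effective. *)
Lemma eventually_not_dvd (C : nat) :
  exists m0, forall m b, m0 <= m -> 0 < b <= C -> ~~ (3 ^ m - 1 %| b * (4 ^ m - 1)).
Proof.
pose M0 := (64 * (2 * (256 * C ^ 3))).+1.
pose solution m := exists2 b, 0 < b <= C & 3 ^ m - 1 %| b * (4 ^ m - 1).
have [[M [M_ge [b1 b1C dvd1]]] | none] :=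
  classic (exists M, M0 <= M /\ solution M); last first.
  exists M0 => m b m_ge bC; apply/negP => dvd; apply: none.
  by exists m; split => //; exists b.
exists ((2 * C + 4 * M) * (4 * M) + 2 * M) => m b2 m_ge b2C; apply/negP => dvd2.
have M_gt0 : 0 < M by apply: leq_trans M_ge.
(* This makes l = 2 e + 1 the largest odd number with 2 l M <= m. *)
pose e := (m - 2 * M) %/ (4 * M).
have e_ge : 2 * C + 4 * M <= e.
  rewrite leq_divRL ?muln_gt0 // leq_subRL ?[2 * M + _]addnC //.
  by rewrite (leq_trans _ m_ge) ?leq_addl.
apply: (no_second_solution b1C b2C dvd1 dvd2 M_gt0 (l := (2 * e).+1)).
- rewrite mulnA; apply: expn_dominates => //.
  by apply: leq_trans M_ge; apply: leqnSn.
- by rewrite /= oddM.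
- apply: (@leq_trans (2 ^ (4 * C + 8 * M))).
    by rewrite expnD [2 ^ (8 * M)]expnM ltn_pmul2r ?expn_gt0 // ltn_expl.
  by rewrite leq_exp2l //; move: e_ge; clear; lia.
have -> : 2 * ((2 * e).+1 * M) = e * (4 * M) + 2 * M by rewrite mulSn; lia.
have m_ge2 : 2 * M <= m by rewrite (leq_trans _ m_ge) ?leq_addl.
rewrite -[m in _ <= m <= _](subnK m_ge2) leq_add2r leq_trunc_div /=.
by rewrite addnAC leq_add2r -mulSnr ltnW // ltn_ceil ?muln_gt0.
Qed.

(** * The k-th smallest value of a family *)

Lemma kth_smallest_exists (I : eqType) (P : pred I) (f : I -> nat) (k : nat) :
  (forall r : seq I, exists2 i, P i & i \notin r) ->
  exists B, is_kth_smallest P f k B.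
Proof.
move=> inf; elim: k => [|k [B [r [[r_uniq r_size rP] [r_sorted r_last r_min]]]]].
  by exists 0, [::].
have [i [Pi ir i_min]] : exists i, [/\ P i, i \notin r
    & forall j, P j -> j \notin r -> f i <= f j].
  have [i Pi ir] := inf r; have [n] := ubnP (f i).
  elim: n => // n IHn in i Pi ir * => lt_fi.
  have [[j [Pj jr ltj]] | no] :=
    classic (exists j, [/\ P j, j \notin r & f j < f i]).
    by apply: (IHn j) => //; apply: leq_trans ltj _.
  exists i; split=> // j Pj jr; rewrite leqNgt; apply/negP => ltj.
  by apply: no; exists j.
exists (f i), (rcons r i); split; split.
- by rewrite rcons_uniq ir.
- by rewrite size_rcons r_size.
- by rewrite all_rcons Pi.
- rewrite map_rcons; case: (r) r_sorted r_last => //= j r' r'_sorted r'_last.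
  by rewrite rcons_path r'_sorted r'_last r_min.
- by rewrite map_rcons last_rcons.
move=> j Pj; rewrite mem_rcons inE negb_or => /andP[_ jr]; exact: i_min.
Qed.

Lemma kth_smallest_mem (I : eqType) (P : pred I) (f : I -> nat) k B :
  is_kth_smallest P f k B -> 0 < k -> exists2 i, P i & f i = B.
Proof.
case=> r [[_ r_size rP] [_ <- _]] k_gt0.
case/lastP: r r_size rP => [eq0|r i _]; first by rewrite -eq0 in k_gt0.
by rewrite all_rcons map_rcons last_rcons => /andP[Pi _]; exists i.
Qed.

Lemma kth_smallest_seq (I : eqType) (P : pred I) (f : I -> nat) k B :
  is_kth_smallest P f k B ->
  exists r, [/\ uniq r, size r = k, all P r & {in r, forall i, f i <= B}].
Proof.
case=> r [[r_uniq r_size rP] [r_sorted <- _]]; exists r; split=> // i r_i.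
move: r_sorted (map_f f r_i); rewrite (sorted_pairwise leq_trans).
case/lastP: (map f r) => // s x.
rewrite pairwise_rcons last_rcons => /andP[/allP le_x _].
by rewrite mem_rcons inE => /predU1P[-> // | /le_x].
Qed.

(** Either L contains an index outside the list that defines B, and its value is
    at least B, or L consists of the k indices of that list, one of which has
    value B. *)
Lemma kth_smallest_le (I : eqType) (P : pred I) (f : I -> nat) k B L K :
    is_kth_smallest P f k B -> 0 < k -> uniq L -> all P L -> k <= size L ->
    {in L, forall i, f i <= K} ->
  B <= K.
Proof.
move=> [r [[r_uniq r_size rP] [_ r_last r_min]]] k_gt0 L_uniq LP leL LK.
have [/allP rL | /allPn[i iL ir]] := boolP (all [in r] L); last first.
  by apply: leq_trans (LK _ iL); apply: r_min => //; apply: (allP LP).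
have [_ eq_rL] := uniq_min_size L_uniq rL (leq_trans (eq_leq r_size) leL).
have : B \in map f r.
  by rewrite -r_last; case: (r) r_size k_gt0 => [<- //|j r' _ _] /=; apply: mem_last.
by case/mapP => i ir ->; apply: LK; rewrite eq_rL.
Qed.

(** More than k indices of value at most B cannot all be among the k indices
    that define B; one that is not has value exactly B, like the last of the k. *)
Lemma kth_smallest_tie (I : eqType) (P : pred I) (f : I -> nat) k B L :
    is_kth_smallest P f k B -> 0 < k -> uniq L -> all P L -> k < size L ->
    {in L, forall i, f i <= B} ->
  exists i j, [/\ i != j, f i = B & f j = B].
Proof.
move=> [r [[r_uniq r_size rP] [_ r_last r_min]]] k_gt0 L_uniq LP ltL LB.
have [/allP rL | /allPn[i iL ir]] := boolP (all [in r] L).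
  by have := uniq_leq_size L_uniq rL; rewrite r_size leqNgt ltL.
have : B \in map f r.
  by rewrite -r_last; case: (r) r_size k_gt0 => [<- //|j r' _ _] /=; apply: mem_last.
case/mapP => j jr fj; exists i, j; split=> //.
  by apply: contraNneq ir => ->.
by apply/eqP; rewrite eqn_leq LB // r_min // (allP LP).
Qed.

(** * Ways with terms at most 4 *)

Definition terms_lt5 (s : seq nat) := all (fun a => 0 < a < 5) s.

Lemma sum_lt5 (F : nat -> nat) s : terms_lt5 s ->
  \sum_(a <- s) F a = count_mem 1 s * F 1 + count_mem 2 s * F 2
                      + count_mem 3 s * F 3 + count_mem 4 s * F 4.
Proof.
elim: s => [|a s IHs]; first by rewrite big_nil.
rewrite big_cons => /andP[/andP[a_gt0 a_lt5] /IHs->] /=.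
by case: a a_gt0 a_lt5 => [|[|[|[|[|]]]]] //= _ _; rewrite !add0n !mulnDl; lia.
Qed.

Lemma perm_lt5 s1 s2 : terms_lt5 s1 -> terms_lt5 s2 ->
    {in [:: 1; 2; 3; 4], forall j, count_mem j s1 = count_mem j s2} ->
  perm_eq s1 s2.
Proof.
move=> sm1 sm2 eq12; apply/allP => j; rewrite mem_cat => j12; apply/eqP/eq12.
have /andP[] : 0 < j < 5 by case/orP: j12 => [/(allP sm1)|/(allP sm2)].
by case: j {j12} => [|[|[|[|[|]]]]].
Qed.

Lemma way_excess n m N s : is_way n m N s -> terms_lt5 s ->
  [/\ count_mem 1 s + count_mem 2 s + count_mem 3 s + count_mem 4 s = n
    & N = n + count_mem 2 s * (2 ^ m - 1) + count_mem 3 s * (3 ^ m - 1)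
            + count_mem 4 s * (4 ^ m - 1)].
Proof.
case/and3P=> /eqP <- _ /eqP <- sm.
have sizeE := sum_lt5 (fun=> 1) sm; rewrite sum1_size !muln1 in sizeE.
split=> //; rewrite (sum_lt5 (fun a => a ^ m) sm) sizeE exp1n muln1.
have pos j : 0 < j.+1 ^ m by rewrite expn_gt0.
rewrite -[in LHS](subnK (pos 1)) -[in LHS](subnK (pos 2)) -[in LHS](subnK (pos 3)).
by rewrite !mulnDr !muln1; lia.
Qed.

(** Each of the other n - 1 terms contributes at least 1 to N. *)
Lemma way_lt5 n m N s :
  is_way n m N s -> N < n + (5 ^ m - 1) -> terms_lt5 s.
Proof.
case/and3P=> /eqP <- s_pos /eqP <- ltN; apply/allP => a a_s.
rewrite (allP s_pos) //= ltnNge; apply/negP => a_ge5.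
have : size (rem a s) <= \sum_(b <- rem a s) b ^ m.
  rewrite -sum1_size !big_seq; apply: leq_sum => b b_s.
  by rewrite expn_gt0 (allP s_pos) // (mem_rem b_s).
have : 5 ^ m <= a ^ m by apply: leq_expn2r.
have : 0 < 5 ^ m by rewrite expn_gt0.
have := perm_to_rem a_s; move: ltN => + perm_s.
rewrite (perm_size perm_s) (perm_big _ perm_s) big_cons /=.
by move: (5 ^ m) (a ^ m) => u v; clear; lia.
Qed.

(** * The two exchanges *)

(** In terms of x, y, d, l3 and l4 above, these are d, x, y, l3 and l4, followed
    by the number of twos that p.1 and p.2 exchanges use up. *)
Definition exch_gcd m := gcdn (3 ^ m - 2 ^ m) (2 ^ m - 1).
Definition exch_threes m := (2 ^ m - 1) %/ exch_gcd m.
Definition exch_ones m := (3 ^ m - 2 ^ m) %/ exch_gcd m.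
Definition exch_size3 m := (3 ^ m - 1) %/ exch_gcd m.
Definition exch_size4 m := 2 ^ m + 1.
Definition exch_size m (p : nat * nat) := p.1 * exch_size3 m + p.2 * exch_size4 m.

Lemma exchange_facts m : 0 < m ->
  [/\ 0 < exch_gcd m, exch_threes m * exch_gcd m = 2 ^ m - 1,
      exch_size3 m * exch_gcd m = 3 ^ m - 1,
      exch_threes m + exch_ones m = exch_size3 m
    & coprime (exch_threes m) (exch_size3 m)].
Proof.
move=> m_gt0; have gt2 : 1 < 2 ^ m by rewrite -(expn0 2) ltn_exp2l.
have lt23 : 2 ^ m < 3 ^ m by rewrite ltn_exp2r.
have d_gt0 : 0 < exch_gcd m by rewrite gcdn_gt0 !subn_gt0 gt2 orbT.
have sum_eq : 3 ^ m - 1 = (2 ^ m - 1) + (3 ^ m - 2 ^ m).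
  by move: (2 ^ m) (3 ^ m) gt2 lt23 => u v; clear; lia.
have dvd1 : exch_gcd m %| 2 ^ m - 1 by rewrite dvdn_gcdr.
have dvd2 : exch_gcd m %| 3 ^ m - 2 ^ m by rewrite dvdn_gcdl.
have dvd3 : exch_gcd m %| 3 ^ m - 1 by rewrite sum_eq dvdn_add.
split; rewrite ?divnK //; first by rewrite /exch_size3 sum_eq divnDl.
rewrite /coprime -(eqn_pmul2r d_gt0) muln_gcdl !divnK // mul1n sum_eq.
by rewrite gcdnDl gcdnC.
Qed.

Lemma exchange_excess m : 0 < m ->
  exch_threes m * (3 ^ m - 1) = exch_size3 m * (2 ^ m - 1).
Proof.
by case/exchange_facts => _ <- <- _ _; rewrite mulnCA.
Qed.

Lemma exchange_sum m : 0 < m ->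
  exch_threes m * 3 ^ m + exch_ones m = exch_size3 m * 2 ^ m.
Proof.
move=> m_gt0; have [_ _ _ size3E _] := exchange_facts m_gt0.
have := exchange_excess m_gt0; rewrite -size3E !mulnBr !muln1.
have le1 j : 0 < j -> exch_threes m <= exch_threes m * j ^ m.
  by move=> j_gt0; rewrite leq_pmulr // expn_gt0 j_gt0.
have le2 : exch_ones m <= exch_ones m * 2 ^ m by rewrite leq_pmulr // expn_gt0.
move: (le1 2 isT) (le1 3 isT) le2; rewrite !mulnDl.
move: (_ * 3 ^ m) (exch_threes m * 2 ^ m) (_ * 2 ^ m) => u v w.
by clear; lia.
Qed.

Lemma size4_excess m : exch_size4 m * (2 ^ m - 1) = 4 ^ m - 1.
Proof.
rewrite -[4]/(2 ^ 2) -expnM mulnC [2 * m]mulnC expnM.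
by rewrite -[in RHS](exp1n 2) subn_sqr.
Qed.

Lemma exch_size_gt0 m p : 0 < m -> p != (0, 0) -> 0 < exch_size m p.
Proof.
move=> m_gt0; have [d_gt0 _ l3E _ _] := exchange_facts m_gt0.
have l3_gt0 : 0 < exch_size3 m.
  have : 0 < exch_size3 m * exch_gcd m.
    by rewrite l3E subn_gt0 -{1}(expn0 3) ltn_exp2l.
  by rewrite muln_gt0 => /andP[].
have l4_gt0 : 0 < exch_size4 m by rewrite /exch_size4 addn1.
case: p => [[|a] [|b]] // _;
  by rewrite addn_gt0 !muln_gt0 /= ?l3_gt0 ?l4_gt0 ?orbT.
Qed.

(** B twos and n - B ones, after p.1 exchanges of the first kind and p.2 of the
    second. *)
Definition exch_way m n B (p : nat * nat) : seq nat :=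
  nseq (p.1 * exch_threes m) 3 ++ nseq p.2 4
  ++ nseq (p.1 * exch_ones m + p.2 * 2 ^ m + (n - B)) 1
  ++ nseq (B - exch_size m p) 2.

Lemma exch_way_is_way m n B p :
  0 < m -> B <= n -> exch_size m p <= B ->
  is_way n m (n + B * (2 ^ m - 1)) (exch_way m n B p).
Proof.
move=> m_gt0 leBn le_pB; have [_ _ _ size3E _] := exchange_facts m_gt0.
have gt2 : 0 < 2 ^ m by rewrite expn_gt0.
apply/and3P; split.
- rewrite !size_cat !size_nseq; apply/eqP.
  move: le_pB; rewrite /exch_size -size3E /exch_size4 !mulnDr muln1.
  move: (p.1 * exch_threes m) (p.1 * exch_ones m) (p.2 * 2 ^ m) leBn.
  by clear; lia.
- by rewrite !all_cat !all_nseq !orbT.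
rewrite !big_cat /= !big_nseq !iter_addn_0 exp1n !mul1n.
have E3 : p.1 * exch_threes m * 3 ^ m + p.1 * exch_ones m
    = p.1 * exch_size3 m * 2 ^ m.
  by rewrite -!mulnA -mulnDr exchange_sum.
have E4 : p.2 * 4 ^ m + p.2 * 2 ^ m = p.2 * exch_size4 m * 2 ^ m.
  by rewrite -mulnA -mulnDr mulnDl mul1n -expnD addnn -mul2n expnM.
have EB : (B - exch_size m p) * 2 ^ m + exch_size m p * 2 ^ m = B * 2 ^ m.
  by rewrite -mulnDl subnK.
move: EB E3 E4; rewrite {2}/exch_size mulnDl.
have : B <= B * 2 ^ m by rewrite leq_pmulr.
rewrite ![_ ^ m * _]mulnC [B * (_ - _)]mulnBr muln1.
move: (B * 2 ^ m) ((B - _) * 2 ^ m) (_ * 3 ^ m) (_ * 4 ^ m) leBn.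
move: (p.1 * exch_size3 m * 2 ^ m) (p.2 * exch_size4 m * 2 ^ m).
move: (p.1 * exch_ones m) (p.2 * 2 ^ m); clear.
by move=> *; apply/eqP; lia.
Qed.

Lemma exch_way_inj m n n' B B' p p' : 0 < m ->
  perm_eq (exch_way m n B p) (exch_way m n' B' p') -> p = p'.
Proof.
move=> m_gt0 /permP eq_cnt.
have x_gt0 : 0 < exch_threes m.
  have [_ xE _ _ _] := exchange_facts m_gt0.
  by move: xE; case: exch_threes => //; rewrite mul0n => /esym/eqP;
    rewrite subn_eq0 leqNgt -{1}(expn0 2) ltn_exp2l ?m_gt0.
move: (eq_cnt (pred1 3)) (eq_cnt (pred1 4)).
rewrite !count_cat !count_nseq /= !mul0n !mul1n !addn0 !add0n.
move=> /eqP; rewrite eqn_pmul2r // => /eqP e1 e2.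
by rewrite [p]surjective_pairing [p']surjective_pairing e1 e2.
Qed.

Lemma arg_min_seq (T : eqType) (f : T -> nat) (x0 : T) (s : seq T) : x0 \in s ->
  exists2 x, x \in s & {in s, forall y, f x <= f y}.
Proof.
move=> s_x0; have [n] := ubnP (f x0); elim: n => // n IHn in x0 s_x0 * => lt_n.
have [/allP min | /allPn[y s_y]] := boolP (all (fun y => f x0 <= f y) s).
  by exists x0.
by rewrite -ltnNge => lt_y; apply: (IHn y) => //; apply: leq_trans lt_y _.
Qed.

(** Here c is the least number of threes in a way.  A way s1 that attains it
    shows that the excess without c threes is k (2^m - 1).  Comparing another way
    with s1, the surplus of threes times 3^m - 1 is a multiple of 2^m - 1, so the
    surplus is a multiple a x of x, as x and l3 are coprime; and a way is
    determined by a and its number of fours.  The last clause says that a way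
    without threes in surplus and without fours contains c threes and k twos. *)
Lemma ways_exchange m n N W :
    0 < m -> W != [::] -> all (is_way n m N) W ->
    pairwise (fun s1 s2 => ~~ perm_eq s1 s2) W -> N < n + (5 ^ m - 1) ->
  exists c k L,
    [/\ N = n + c * (3 ^ m - 1) + k * (2 ^ m - 1), uniq L, size L = size W,
        {in L, forall p, exch_size m p <= k}
      & (0, 0) \in L -> c + k <= n].
Proof.
move=> m_gt0 W_neq0 W_ways W_diff ltN.
have [d_gt0 xE l3E _ co_x_l3] := exchange_facts m_gt0.
have w2_gt0 : 0 < 2 ^ m - 1 by rewrite subn_gt0 -{1}(expn0 2) ltn_exp2l.
have x_gt0 : 0 < exch_threes m by move: w2_gt0; rewrite -xE muln_gt0 => /andP[].
have W_lt5 s : s \in W -> terms_lt5 s.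
  by move=> Ws; apply: way_lt5 ltN; apply: (allP W_ways).
have W_excess s (Ws : s \in W) := way_excess (allP W_ways s Ws) (W_lt5 s Ws).
have [s0 Ws0] : exists s0, s0 \in W.
  by case: (W) W_neq0 => // s0 W' _; exists s0; rewrite mem_head.
have {Ws0}[s1 Ws1 min_s1] := arg_min_seq (fun s => count_mem 3 s) Ws0.
set c := count_mem 3 s1 in min_s1.
pose k := count_mem 2 s1 + count_mem 4 s1 * exch_size4 m.
pose a s := (count_mem 3 s - c) %/ exch_threes m.
have NE : N = n + c * (3 ^ m - 1) + k * (2 ^ m - 1).
  have [_ ->] := W_excess s1 Ws1; rewrite /k mulnDl -mulnA size4_excess.
  by rewrite -!addnA [count_mem 2 s1 * _ + _]addnCA.
have W_coef s : s \in W -> count_mem 3 s = c + a s * exch_threes m /\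
    k = count_mem 2 s + exch_size m (a s, count_mem 4 s).
  move=> Ws; have le_c := min_s1 s Ws; have [_ NE'] := W_excess s Ws.
  have excessE : k * (2 ^ m - 1) = (count_mem 3 s - c) * (3 ^ m - 1)
      + (count_mem 2 s + count_mem 4 s * exch_size4 m) * (2 ^ m - 1).
    rewrite mulnDl -mulnA size4_excess mulnBl.
    have : c * (3 ^ m - 1) <= count_mem 3 s * (3 ^ m - 1).
      by rewrite leq_mul2r le_c orbT.
    move: NE; rewrite NE'.
    move: (k * _) (c * _) (_ * (2 ^ m - 1)) (_ * (3 ^ m - 1)) (_ * (4 ^ m - 1)).
    by clear; lia.
  have x_dvd : exch_threes m %| count_mem 3 s - c.
    rewrite -(Gauss_dvdl _ co_x_l3) -(dvdn_pmul2r d_gt0) -mulnA xE l3E.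
    have := dvdn_mull k (dvdnn (2 ^ m - 1)).
    by rewrite excessE dvdn_addl // dvdn_mull.
  split; first by rewrite divnK // subnKC.
  apply/eqP; rewrite -(eqn_pmul2r w2_gt0) excessE /exch_size /= !mulnDl.
  rewrite -[in X in _ == _ + (X + _)]mulnA -exchange_excess // mulnA divnK //.
  by rewrite addnCA.
exists c, k, [seq (a s, count_mem 4 s) | s <- W]; split=> //.
- rewrite uniq_pairwise pairwise_map; move: W_diff.
  apply: (@sub_in_pairwise _ [in W]) => [s s' Ws Ws' | ]; last exact/allP.
  apply: contraNneq => [[eq_a eq_4]].
  have [e3 e2] := W_coef s Ws; have [e3' e2'] := W_coef s' Ws'.
  have [e1 _] := W_excess s Ws; have [e1' _] := W_excess s' Ws'.
  have eq3 : count_mem 3 s = count_mem 3 s' by rewrite e3 e3' eq_a.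
  have eq2 : count_mem 2 s = count_mem 2 s'.
    apply/eqP; rewrite -(eqn_add2r (exch_size m (a s, count_mem 4 s))) -e2.
    by rewrite {1}e2' eq_a eq_4.
  have eq1 : count_mem 1 s = count_mem 1 s'.
    by apply/eqP; rewrite -(eqn_add2r (count_mem 2 s)) -(eqn_add2r (count_mem 3 s))
      -(eqn_add2r (count_mem 4 s)) e1 -e1' eq2 eq3 eq_4.
  apply: perm_lt5 (W_lt5 s Ws) (W_lt5 s' Ws') _ => j.
  by rewrite !inE => /or4P[] /eqP->.
- by rewrite size_map.
- by move=> _ /mapP[s Ws ->]; have [_ ->] := W_coef s Ws; rewrite leq_addl.
case/mapP => s Ws [a0 c4].
have [e3 e2] := W_coef s Ws; have [<- _] := W_excess s Ws.
rewrite e3 -a0 e2 -a0 -c4 /exch_size /= !mul0n !addn0.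
by rewrite addnC leq_add2r leq_addl.
Qed.

(** * The least number with t ways *)

Definition exch_bound t m B :=
  is_kth_smallest (fun p : nat * nat => p != (0, 0)) (exch_size m) (t - 1) B.

Lemma exch_bound_exists t m : exists B, exch_bound t m B.
Proof.
apply: kth_smallest_exists => r.
pose L := [seq (0, i) | i <- iota 1 (size r).+1].
have L_uniq : uniq L by rewrite map_inj_uniq ?iota_uniq // => i j [].
have [/allP rL | /allPn[p p_L p_r]] := boolP (all [in r] L).
  by have := uniq_leq_size L_uniq rL; rewrite size_map size_iota ltnn.
exists p => //; have /mapP[i i_gt0 ->] := p_L.
by move: i_gt0; rewrite mem_iota; case: i.
Qed.

(** The pairs (0, 1), ..., (0, t - 1) have values at most (t - 1) l4. *)
Lemma exch_bound_le t m B :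
  2 <= t -> exch_bound t m B -> B <= (t - 1) * exch_size4 m.
Proof.
move=> t_ge2 Bkth.
apply: (kth_smallest_le Bkth (L := [seq (0, i) | i <- iota 1 (t - 1)])).
- by rewrite subn_gt0.
- by rewrite map_inj_uniq ?iota_uniq // => i j [].
- by apply/allP => _ /mapP[[|i] + ->] //; rewrite mem_iota.
- by rewrite size_map size_iota.
move=> _ /mapP[i + ->]; rewrite mem_iota /exch_size /= mul0n add0n leq_mul2r.
by move=> /andP[_ lt_i]; rewrite -ltnS -add1n lt_i orbT.
Qed.

Lemma exch_bound_excess t m B :
    2 <= t -> 0 < m -> t * 4 ^ m <= 5 ^ m -> exch_bound t m B ->
  B * (2 ^ m - 1) < 5 ^ m - 1.
Proof.
move=> t_ge2 m_gt0 m_big Bkth.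
apply: (@leq_ltn_trans ((t - 1) * (4 ^ m - 1))).
  by rewrite -size4_excess mulnA leq_mul2r exch_bound_le ?orbT.
have : 1 < 4 ^ m by rewrite -(expn0 4) ltn_exp2l.
rewrite mulnBl mulnBr mul1n muln1.
move: (4 ^ m) (5 ^ m) m_big => u v; clear -t_ge2.
have : u <= t * u by rewrite leq_pmull // ltnW.
by lia.
Qed.

Lemma ways_exist t m B n :
    2 <= t -> 0 < m -> exch_bound t m B -> B <= n ->
  in_at_least_ways n m t (n + B * (2 ^ m - 1)).
Proof.
move=> t_ge2 m_gt0 Bkth leBn.
have [r [r_uniq r_size r_nz r_le]] := kth_smallest_seq Bkth.
exists [seq exch_way m n B p | p <- (0, 0) :: r]; split.
- by rewrite size_map /= r_size subn1 prednK // ltnW.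
- apply/allP => _ /mapP[p p_r ->]; apply: exch_way_is_way => //.
  by move: p_r; rewrite inE => /predU1P[-> // | /r_le].
rewrite pairwise_map.
have : uniq ((0, 0) :: r).
  by rewrite /= r_uniq andbT; apply/negP => /(allP r_nz).
rewrite uniq_pairwise; apply: sub_pairwise => p p' /=.
by apply: contraNN => /exch_way_inj ->.
Qed.

(** Of t distinct pairs at least t - 1 are nonzero, so one of them has value at
    least B. *)
Lemma exch_bound_min t m B k (L : seq (nat * nat)) :
    2 <= t -> exch_bound t m B -> uniq L -> size L = t ->
    {in L, forall p, exch_size m p <= k} ->
  B <= k.
Proof.
move=> t_ge2 Bkth L_uniq L_size L_le.
apply: (kth_smallest_le Bkth (L := rem (0, 0) L)).
- by rewrite subn_gt0.
- exact: rem_uniq.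
- by apply/allP => p; rewrite mem_rem_uniq // inE => /andP[].
- rewrite -L_size; have [in_L | notin_L] := boolP ((0, 0) \in L).
    by rewrite size_rem // subn1.
  by rewrite rem_id // leq_subr.
by move=> p /mem_rem /L_le.
Qed.

Lemma ways_lower_bound t m B n N :
    2 <= t -> 0 < m -> t * 4 ^ m <= 5 ^ m -> exch_bound t m B ->
    in_at_least_ways n m t N ->
  n + B * (2 ^ m - 1) <= N.
Proof.
move=> t_ge2 m_gt0 m_big Bkth [W [W_size W_ways W_diff]].
have [ltN | ] := ltnP N (n + (5 ^ m - 1)); last first.
  by apply: leq_trans; rewrite leq_add2l ltnW // (exch_bound_excess t_ge2).
have W_neq0 : W != [::] by rewrite -size_eq0 W_size -lt0n ltnW.
have [c [k [L [-> L_uniq L_size L_le _]]]] :=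
  ways_exchange m_gt0 W_neq0 W_ways W_diff ltN.
rewrite W_size in L_size.
rewrite -addnA leq_add2l (leq_trans _ (leq_addl _ _)) // leq_mul2r.
by rewrite (exch_bound_min t_ge2 Bkth L_uniq L_size L_le) orbT.
Qed.

Lemma is_T_bound t m B n :
    2 <= t -> 0 < m -> t * 4 ^ m <= 5 ^ m -> exch_bound t m B -> B <= n ->
  is_T n m t (n + B * (2 ^ m - 1)).
Proof.
move=> t_ge2 m_gt0 m_big Bkth leBn; split; first exact: ways_exist.
by move=> N; apply: ways_lower_bound.
Qed.

(** * Ties and the seed number *)

(** A tie a l3 = b l4 gives b (4^m - 1) = b l4 (2^m - 1) = a l3 (2^m - 1)
    = a x (3^m - 1). *)
Lemma tie_dvd m (p p' : nat * nat) :
    0 < m -> exch_size m p = exch_size m p' -> p.2 <= p'.2 ->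
  3 ^ m - 1 %| (p'.2 - p.2) * (4 ^ m - 1).
Proof.
move=> m_gt0 tie le_pp'.
have -> : (p'.2 - p.2) * (4 ^ m - 1)
    = (p.1 - p'.1) * exch_threes m * (3 ^ m - 1).
  rewrite -size4_excess -[in RHS]mulnA exchange_excess // !mulnA.
  congr (_ * _); move: tie; rewrite /exch_size !mulnBl.
  have : p.2 * exch_size4 m <= p'.2 * exch_size4 m.
    by rewrite leq_mul2r le_pp' orbT.
  by lia.
by rewrite dvdn_mull.
Qed.

(** A way that corresponds to the pair (0, 0) would contain k >= B > n twos
    among its n terms.  So all of the t pairs are nonzero, and their values are
    at most k <= B, which forces a tie. *)
Lemma short_way_dvd t m B n :
    2 <= t -> 0 < m -> t * 4 ^ m <= 5 ^ m -> exch_bound t m B -> n < B ->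
    in_at_least_ways n m t (n + B * (2 ^ m - 1)) ->
  exists2 b, 0 < b <= t - 1 & 3 ^ m - 1 %| b * (4 ^ m - 1).
Proof.
move=> t_ge2 m_gt0 m_big Bkth lt_nB [W [W_size W_ways W_diff]].
have W_neq0 : W != [::] by rewrite -size_eq0 W_size -lt0n ltnW.
have ltN : n + B * (2 ^ m - 1) < n + (5 ^ m - 1).
  by rewrite ltn_add2l (exch_bound_excess t_ge2).
have [c [k [L [NE L_uniq L_size L_le L_zero]]]] :=
  ways_exchange m_gt0 W_neq0 W_ways W_diff ltN.
rewrite W_size in L_size.
have le_Bk := exch_bound_min t_ge2 Bkth L_uniq L_size L_le.
have le_kB : k <= B.
  have w2_gt0 : 0 < 2 ^ m - 1 by rewrite subn_gt0 -{1}(expn0 2) ltn_exp2l.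
  by rewrite -(leq_pmul2r w2_gt0) -(leq_add2l n) NE leq_add2r leq_addr.
have L_nz : all (fun p => p != (0, 0)) L.
  apply/allP => p p_L; apply/eqP => p0; rewrite p0 in p_L.
  have := leq_trans (leq_addl c k) (L_zero p_L).
  by rewrite leqNgt (leq_trans lt_nB).
have t1_gt0 : 0 < t - 1 by rewrite subn_gt0.
have lt_L : t - 1 < size L by rewrite L_size ltn_subrL /= ltnW.
have L_leB : {in L, forall p, exch_size m p <= B}.
  by move=> p /L_le /leq_trans; apply.
have [p [p' [neq_pp' pB p'B]]] :=
  kth_smallest_tie Bkth t1_gt0 L_uniq L_nz lt_L L_leB.
have l4_gt0 : 0 < exch_size4 m by rewrite /exch_size4 addn1.
have snd_le q : exch_size m q = B -> q.2 <= t - 1.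
  move=> qB; rewrite -(leq_pmul2r l4_gt0).
  apply: leq_trans (exch_bound_le t_ge2 Bkth).
  by rewrite -qB leq_addl.
case: (ltngtP p.2 p'.2) => [lt_pp' | lt_p'p | eq_2].
- exists (p'.2 - p.2); last by apply: tie_dvd; rewrite ?pB ?p'B // ltnW.
  by rewrite subn_gt0 lt_pp' (leq_trans (leq_subr _ _)) ?snd_le.
- exists (p.2 - p'.2); last by apply: tie_dvd; rewrite ?pB ?p'B // ltnW.
  by rewrite subn_gt0 lt_p'p (leq_trans (leq_subr _ _)) ?snd_le.
have l3_gt0 : 0 < exch_size3 m.
  by have := @exch_size_gt0 m (1, 0) m_gt0 isT; rewrite /exch_size mul1n addn0.
move: pB; rewrite -p'B /exch_size eq_2 => /eqP; rewrite eqn_add2r eqn_pmul2r //.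
move=> /eqP eq_1; case/eqP: neq_pp'.
by rewrite [p]surjective_pairing [p']surjective_pairing eq_1 eq_2.
Qed.

Theorem theorem5p1 :
  forall t : nat, 2 <= t ->
  exists m0 : nat, forall m : nat, m0 <= m ->
  let d := gcdn (3 ^ m - 2 ^ m) (2 ^ m - 1) in
  let l3 := (3 ^ m - 1) %/ d in
  let l4 := 2 ^ m + 1 in
  exists s B : nat,
    [/\ is_seed_number m t s,
        is_kth_smallest (fun p : nat * nat => p != (0, 0))
          (fun p => p.1 * l3 + p.2 * l4) (t - 1) B,
        s <= B
      & is_seed_value m t (s * 2 ^ m)].
Proof.
move=> t t_ge2; have [m1 no_dvd] := eventually_not_dvd (t - 1).
exists (m1 + 4 * t) => m m_ge d l3 l4.
have m_ge1 : m1 <= m by apply: leq_trans m_ge; apply: leq_addr.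
have m_ge4t : 4 * t <= m by apply: leq_trans m_ge; apply: leq_addl.
have m_gt0 : 0 < m by apply: leq_trans m_ge4t; rewrite muln_gt0 /= ltnW.
have m_big : t * 4 ^ m <= 5 ^ m by apply: expn_dominates.
have [B Bkth] := exch_bound_exists t m.
have T_eq n := is_T_bound (n := n) t_ge2 m_gt0 m_big Bkth.
have B_gt0 : 0 < B.
  have t1_gt0 : 0 < t - 1 by rewrite subn_gt0.
  by have [p p_nz <-] := kth_smallest_mem Bkth t1_gt0; apply: exch_size_gt0.
have seedB : is_seed_number m t B.
  split=> [|y [y_gt0 y_seed]].
    split=> // n leBn; exists (n + B * (2 ^ m - 1)); split; first exact: T_eq.
    by rewrite -addSn; apply: T_eq; apply: leqW.
  rewrite leqNgt; apply/negP => lt_yB.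
  have [|v [[v_ways _] T_v1]] := y_seed B.-1; first by rewrite -ltnS prednK.
  rewrite prednK // in T_v1.
  have [B_ways B_min] := T_eq B (leqnn B); have [v1_ways v1_min] := T_v1.
  have vE : v = B.-1 + B * (2 ^ m - 1).
    apply: succn_inj; rewrite -addSn prednK //.
    by apply/eqP; rewrite eqn_leq v1_min // B_min.
  rewrite vE in v_ways.
  have lt_predB : B.-1 < B by rewrite prednK.
  have [b b_le b_dvd] := short_way_dvd t_ge2 m_gt0 m_big Bkth lt_predB v_ways.
  by have := no_dvd m b m_ge1 b_le; rewrite b_dvd.
exists B, B; split=> //; exists B; split=> //.
have -> : B * 2 ^ m = B + B * (2 ^ m - 1).
  by rewrite mulnBr muln1 subnKC // leq_pmulr // expn_gt0.
exact: T_eq.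
Qed.
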